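(* Let $\mathfrak g$ be an $8$-dimensional nilpotent real Lie algebra with $4$-dimensional center endowed with an abelian balanced Hermitian structure $(J,F)$. Then $\mathfrak g$ is isomorphic to one and only one of the following Lie algebras, each given by its structure equations with respect to a basis $e^1,\dots,e^8$ of the dual: \begin{enumerate} \item[I.1)] $\mathfrak g_1$: $de^i=0$ for $i=1,2,3,4,5$, $\ de^6=e^{12}-e^{34}$, $\ de^7=e^{13}+e^{24}$, $\ de^8=e^{14}-e^{23}$; \item[I.2)] $\mathfrak g_2$: $de^i=0$ for $i=1,2,3,4,5,6$, $\ de^7=e^{13}+e^{24}$, $\ de^8=e^{14}-e^{23}$; \item[I.3)] $\mathfrak g_3$: $de^i=0$ for $i=1,2,3,4,5,6,7$, $\ de^8=e^{12}-e^{34}$. \end{enumerate}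
   Context: $d$ is the Chevalley-Eilenberg differential: $d\alpha(X,Y)=-\alpha([X,Y])$ for $\alpha\in\mathfrak g^*$, and $e^{ij}=e^i\wedge e^j$; thus $de^k=\sum_{i<j}c_{ij}^ke^{ij}$ means $[e_i,e_j]=-\sum_kc_{ij}^ke_k$ in the dual basis. A complex structure on a real Lie algebra $\mathfrak g$ is a linear map $J$ with $J^2=-\mathrm{Id}$ and $[JX,JY]-J[JX,Y]-J[X,JY]-[X,Y]=0$; it is abelian if $[JX,JY]=[X,Y]$ for all $X,Y$. A Hermitian structure on $\mathfrak g$, $\dim\mathfrak g=2n$, is a pair $(J,g)$ with $J$ a complex structure and $g$ an inner product with $g(JX,JY)=g(X,Y)$, equivalently denoted $(J,F)$ with $F(X,Y)=g(X,JY)$. It is balanced if $d(F^{n-1})=0$ (here $n=4$). $(J,F)$ is abelian balanced if $J$ is abelian and $F$ is balanced. *)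

(* Defs.v *)
From HB Require Import structures.
From mathcomp Require Import all_boot all_order all_fingroup all_algebra.
From mathcomp Require Import sesquilinear reals ring.

Set Implicit Arguments.
Unset Strict Implicit.
Unset Printing Implicit Defensive.

Import GRing.Theory Num.Theory.

Local Open Scope ring_scope.

HB.mixin Record Vector_isLieAlgebra (R : fieldType) V of Vector R V := {
  lie : V -> V -> V;
  lie_is_bilinear : bilinear_for *:%R *:%R lie;
  liexx : forall x, lie x x = 0;
  lie_jacobi : forall x y z,
    lie x (lie y z) + lie y (lie z x) + lie z (lie x y) = 0
}.

#[short(type="lieAlgType")]
HB.structure Definition LieAlgebra (R : fieldType) :=
  {V of Vector_isLieAlgebra R V & Vector R V}.

Notation "[< x , y >]" := (lie x y)
  (at level 0, x at level 99, y at level 99, format "[<  x ,  y  >]")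
  : ring_scope.

HB.instance Definition _ (R : fieldType) (g : lieAlgType R) :=
  bilinear_isBilinear.Build R g g g *:%R *:%R (@lie R g) lie_is_bilinear.

HB.instance Definition _ (R : fieldType) (g : lieAlgType R) (x : g) :=
  GRing.isLinear.Build R g g *:%R (@lie R g x) (lie_is_bilinear.2 x).

Definition lie_isomorphic (R : fieldType) (g h : lieAlgType R) : Prop :=
  exists2 f : {linear g -> h}, bijective f & {morph f : x y / [< x, y >]}.

Section Structure.
Variables (R : fieldType) (g : lieAlgType R).
Implicit Types (x y : g) (U W : {vspace g}).

Definition ad x : 'End(g) := linfun (@lie R g x).

Definition center : {vspace g} := lker (linfun ad).

(* By bilinearity this is the span of all [u, w] with u in U and w in W; see
   [memv_lie_prod]. *)
Definition lie_prod U W : {vspace g} :=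
  <<[seq [< u, w >] | u <- vbasis U, w <- vbasis W]>>%VS.

Fixpoint lower_central (k : nat) : {vspace g} :=
  if k is k'.+1 then lie_prod fullv (lower_central k') else fullv.

Definition nilpotent : Prop := exists k, lower_central k = 0%VS.

Lemma memv_center x : x \in center <-> forall y, [< x, y >] = 0.
Proof.
have adE u v : ad u v = [< u, v >] by rewrite lfunE.
have ad_linear : linear ad.
  move=> a u v; apply/lfunP => w; rewrite add_lfunE scale_lfunE !adE.
  exact: (lie_is_bilinear.1 w a u v).
pose adM := GRing.isLinear.Build R g 'End(g) _ ad ad_linear.
pose adL : {linear g -> 'End(g)} := HB.pack ad adM.
rewrite memv_ker -[ad]/(adL : _ -> _) lfunE /=; split.
  by move=> /eqP/lfunP ad0 y; have := ad0 y; rewrite !lfunE.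
by move=> x0; apply/eqP/lfunP => y; rewrite !lfunE /= x0.
Qed.

Lemma memv_lie_prod U W u w :
  u \in U -> w \in W -> [< u, w >] \in lie_prod U W.
Proof.
move=> /coord_vbasis -> /coord_vbasis ->.
rewrite linear_sumlz rpred_sum // => i _; rewrite linear_sum rpred_sum // => j _.
rewrite linearZ_LR /= linearZl_LR !rpredZ // memv_span //.
by apply: allpairs_f; apply: mem_nth; rewrite size_tuple.
Qed.

End Structure.

Section Forms.
Variables (R : numFieldType) (V : vectType R).

(* k-forms as functions of k vectors: only those that are multilinear and
   alternating are elements of the exterior power of the dual, a subspace that
   the operations below preserve. *)
Definition form (k : nat) : Type := ('I_k -> V) -> R.

Definition wedge p q (a : form p) (b : form q) : form (p + q) := fun v =>
  (p`! * q`!)%:R^-1 *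
  \sum_(s : 'S_(p + q)) (-1) ^+ s * (a (fun i => v (s (lshift q i)))
                                   * b (fun j => v (s (rshift p j)))).

Fixpoint wedge_pow (a : form 2) (m : nat) : form (m * 2) :=
  if m is m'.+1 then wedge a (@wedge_pow a m') else fun _ => 1.

Definition vcons k (x : V) (v : 'I_k -> V) : 'I_k.+1 -> V :=
  fun i => if unlift ord0 i is Some j then v j else x.

Definition vpair (x y : V) : 'I_2 -> V := vcons x (fun _ => y).

(* With this normalisation of the wedge product,
   (a /\ b)(x, y) = a(x) b(y) - a(y) b(x) for 1-forms a and b. *)
Lemma wedge11 (a b : form 1) (f h : V -> R) (v : 'I_(1 + 1) -> V) :
  (forall w, a w = f (w ord0)) -> (forall w, b w = h (w ord0)) ->
  wedge a b v = f (v ord0) * h (v ord_max) - f (v ord_max) * h (v ord0).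
Proof.
move=> aE bE; pose M : 'M[R]_2 :=
  \matrix_(i, j) (if i == ord0 then f (v j) else h (v j)).
transitivity (\det M); last first.
  rewrite (expand_det_row _ ord0) !big_ord_recl big_ord0 /cofactor !det_mx11.
  rewrite !mxE /= expr0 expr1 mul1r addr0 mulN1r mulrN.
  by congr (f (v _) * h (v _) - f (v _) * h (v _)); apply: val_inj.
rewrite /wedge invr1 mul1r /determinant; apply: eq_bigr => s _.
rewrite aE bE !big_ord_recl big_ord0 !mxE /= mulr1.
by congr (_ * (f (v (s _)) * h (v (s _)))); apply: val_inj.
Qed.

End Forms.

Arguments wedge_pow {R V} a m v.

(* The sum over i < j of (-1)^(i+j) a([v_i, v_j], v_0, ..., v_k) with v_i and
   v_j omitted: the second index of the pair is [lift i j], which is j.+1 when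
   i <= j, and the remaining indices are the [lift i (lift j l)]. *)
Definition ce_diff (R : numFieldType) (g : lieAlgType R) (k : nat) :
    form g k -> form g k.+1 :=
  match k return form g k -> form g k.+1 with
  | 0 => fun _ _ => 0
  | k'.+1 => fun a v =>
      \sum_(i < k'.+2) \sum_(j < k'.+1 | (i <= j)%N)
        (-1) ^+ (i + lift i j) *
        a (vcons [< v i, v (lift i j) >] (fun l => v (lift i (lift j l))))
  end.

Lemma ce_diff1 (R : numFieldType) (g : lieAlgType R) (a : form g 1)
    (f : g -> R) (v : 'I_2 -> g) :
  (forall w, a w = f (w ord0)) ->
  ce_diff a v = - f [< v ord0, v ord_max >].
Proof.
move=> aE; rewrite /ce_diff !(big_ord_recl, big_ord0) !big_mkcond /=
  !(big_ord_recl, big_ord0) /= !addr0.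
rewrite aE /vcons unlift_none addn1 expr1 mulN1r.
by have -> : lift ord0 ord0 = ord_max :> 'I_2 by exact: val_inj.
Qed.

Section Hermitian.
Variables (R : realType) (g : lieAlgType R).
Implicit Types (J : 'End(g)) (ip : {dot g for idfun}).

Definition complex_structure J : Prop :=
  (forall x, J (J x) = - x) /\
  (forall x y, [< J x, J y >] - J [< J x, y >] - J [< x, J y >]
               - [< x, y >] = 0).

Definition abelian_complex_structure J : Prop :=
  complex_structure J /\ forall x y, [< J x, J y >] = [< x, y >].

Definition hermitian_structure J ip : Prop :=
  complex_structure J /\ forall x y, ip (J x) (J y) = ip x y.

Definition fundamental_form J ip : form g 2 :=
  fun v => ip (v ord0) (J (v ord_max)).

(* d(F^(n-1)) = 0, where 2n is the dimension of g. *)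
Definition balanced J ip : Prop :=
  forall v,
    ce_diff (wedge_pow (fundamental_form J ip) (\dim {:g})./2.-1) v = 0.

Definition abelian_balanced J ip : Prop :=
  [/\ hermitian_structure J ip, abelian_complex_structure J & balanced J ip].

End Hermitian.

Section StructureEquations.
Variable R : numFieldType.
Local Notation V := 'rV[R]_8.

(* The coordinate 1-forms e^1, ..., e^8: indices start at 1, hence the
   predecessor. *)
Definition e_ (i : nat) : form V 1 := fun v => v ord0 0 (inord i.-1).

Definition ee (i j : nat) : form V 2 := wedge (e_ i) (e_ j).

Lemma eeE i j (v : 'I_2 -> V) :
  ee i j v = v ord0 0 (inord i.-1) * v ord_max 0 (inord j.-1)
           - v ord_max 0 (inord i.-1) * v ord0 0 (inord j.-1).
Proof.
exact: (@wedge11 _ _ _ _ (fun x : V => x 0 (inord i.-1))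
                         (fun x : V => x 0 (inord j.-1))).
Qed.

(* [de_gm k] is the 2-form de^k of the Lie algebra g_m (1 <= k <= 8). *)
Definition de_g1 (k : nat) : form V 2 :=
  match k with
  | 6 => ee 1 2 \- ee 3 4
  | 7 => ee 1 3 \+ ee 2 4
  | 8 => ee 1 4 \- ee 2 3
  | _ => \0
  end.

Definition de_g2 (k : nat) : form V 2 :=
  match k with
  | 7 => ee 1 3 \+ ee 2 4
  | 8 => ee 1 4 \- ee 2 3
  | _ => \0
  end.

Definition de_g3 (k : nat) : form V 2 :=
  match k with
  | 8 => ee 1 2 \- ee 3 4
  | _ => \0
  end.

(* The bracket determined by de^k(x, y) = - e^k([x, y]). *)
Definition lie_of (de : nat -> form V 2) (x y : V) : V :=
  - \row_(k < 8) de k.+1 (vpair x y).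

Lemma vpair0 (x y : V) : vpair x y ord0 = x.
Proof. by rewrite /vpair /vcons unlift_none. Qed.

Lemma vpair1 (x y : V) : vpair x y ord_max = y.
Proof.
rewrite /vpair /vcons.
have -> : ord_max = lift ord0 (ord0 : 'I_1) by exact: val_inj.
by rewrite liftK.
Qed.

Lemma lie_ofE de (x y : V) k : lie_of de x y 0 k = - de k.+1 (vpair x y).
Proof. by rewrite !mxE. Qed.

Lemma ee_vpair i j (x y : V) :
  ee i j (vpair x y) = x 0 (inord i.-1) * y 0 (inord j.-1)
                     - y 0 (inord i.-1) * x 0 (inord j.-1).
Proof. by rewrite eeE vpair0 vpair1. Qed.

Definition two_step_lie (de : nat -> form V 2) : Prop :=
  [/\ bilinear_for *:%R *:%R (lie_of de), forall x, lie_of de x x = 0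
    & forall x y z, lie_of de x (lie_of de y z) = 0].

Lemma lie_of_bilinear de : two_step_lie de -> bilinear_for *:%R *:%R (lie_of de).
Proof. by case. Qed.

Lemma lie_ofxx de : two_step_lie de -> forall x, lie_of de x x = 0.
Proof. by case. Qed.

Lemma lie_of_jacobi de : two_step_lie de -> forall x y z,
  lie_of de x (lie_of de y z) + lie_of de y (lie_of de z x)
  + lie_of de z (lie_of de x y) = 0.
Proof. by case=> _ _ step2 x y z; rewrite !step2 !addr0. Qed.

Ltac solve_two_step de :=
  let deE := fresh in
  have deE : forall k, (k < 4)%N -> forall x y, lie_of de x y 0 (inord k) = 0;
    [by case=> [|[|[|[|]]]] // _ ? ?; rewrite lie_ofE inordK //= oppr0|];
  split; [split=> ? ? ? ? | move=> ? | move=> ? ? ?];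
  apply/rowP => -[[|[|[|[|[|[|[|[|?]]]]]]]] ?] //;
  rewrite !(lie_ofE, mxE) /= ?ee_vpair /= ?deE // ?mxE; ring.

Lemma de_g1_two_step : two_step_lie de_g1. Proof. solve_two_step de_g1. Qed.
Lemma de_g2_two_step : two_step_lie de_g2. Proof. solve_two_step de_g2. Qed.
Lemma de_g3_two_step : two_step_lie de_g3. Proof. solve_two_step de_g3. Qed.

End StructureEquations.

(* R^8 with the brackets given by the structure equations; see
   [structure_g1], [structure_g2] and [structure_g3]. *)
Definition g1 (R : numFieldType) : Type := 'rV[R]_8.
Definition g2 (R : numFieldType) : Type := 'rV[R]_8.
Definition g3 (R : numFieldType) : Type := 'rV[R]_8.

HB.instance Definition _ (R : numFieldType) := Vector.on (g1 R).
HB.instance Definition _ (R : numFieldType) := Vector.on (g2 R).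
HB.instance Definition _ (R : numFieldType) := Vector.on (g3 R).

HB.instance Definition _ (R : numFieldType) :=
  Vector_isLieAlgebra.Build R (g1 R) (lie_of_bilinear (de_g1_two_step R))
    (lie_ofxx (de_g1_two_step R)) (lie_of_jacobi (de_g1_two_step R)).
HB.instance Definition _ (R : numFieldType) :=
  Vector_isLieAlgebra.Build R (g2 R) (lie_of_bilinear (de_g2_two_step R))
    (lie_ofxx (de_g2_two_step R)) (lie_of_jacobi (de_g2_two_step R)).
HB.instance Definition _ (R : numFieldType) :=
  Vector_isLieAlgebra.Build R (g3 R) (lie_of_bilinear (de_g3_two_step R))
    (lie_ofxx (de_g3_two_step R)) (lie_of_jacobi (de_g3_two_step R)).

Section DualBasis.
Variable R : numFieldType.

Lemma ce_diff_e_ (g : lieAlgType R) (de : nat -> form 'rV[R]_8 2)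
    (c : g -> 'rV[R]_8) (k : 'I_8) (v : 'I_2 -> g) :
  (forall x y, c [< x, y >] = lie_of de (c x) (c y)) ->
  ce_diff (fun w : 'I_1 -> g => e_ k.+1 (c \o w)) v
  = de k.+1 (vpair (c (v ord0)) (c (v ord_max))).
Proof.
move=> cE; rewrite (@ce_diff1 _ _ _ (fun x => c x 0 k)); last first.
  by move=> w; rewrite /e_ /= inord_val.
by rewrite cE lie_ofE opprK.
Qed.

Lemma structure_g1 (k : 'I_8) (x y : g1 R) :
  ce_diff (e_ k.+1 : form (g1 R) 1) (vpair x y) = de_g1 k.+1 (vpair x y).
Proof.
by rewrite (@ce_diff_e_ (g1 R) _ id k _ (fun _ _ => erefl)) vpair0 vpair1.
Qed.

Lemma structure_g2 (k : 'I_8) (x y : g2 R) :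
  ce_diff (e_ k.+1 : form (g2 R) 1) (vpair x y) = de_g2 k.+1 (vpair x y).
Proof.
by rewrite (@ce_diff_e_ (g2 R) _ id k _ (fun _ _ => erefl)) vpair0 vpair1.
Qed.

Lemma structure_g3 (k : 'I_8) (x y : g3 R) :
  ce_diff (e_ k.+1 : form (g3 R) 1) (vpair x y) = de_g3 k.+1 (vpair x y).
Proof.
by rewrite (@ce_diff_e_ (g3 R) _ id k _ (fun _ _ => erefl)) vpair0 vpair1.
Qed.

End DualBasis.

(* Main.v *)
From HB Require Import structures.
From mathcomp Require Import all_boot all_order all_fingroup all_algebra.
From mathcomp Require Import sesquilinear reals ring.
Require Import Defs.

(** Let Z be the center of g. It is J-invariant, and V = Z^perp is a J-invariant
complement of dimension 4. Evaluating d(F^3) on a unitary basis from which J d is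
left out turns the balanced condition into a trace identity ([balanced_frame]):
up to terms g([u, d], u), the sum of the brackets [u, J u], over a unitary basis
of the orthogonal complement of d and J d, is orthogonal to J d.

The algebra g is 2-step nilpotent: the quotient g / Z is a nilpotent algebra of
dimension 4 with an abelian J and an induced balanced, hence Kaehler, metric,
and such an algebra is abelian. Concretely, the second center contains a unit
vector e2 orthogonal to Z; choosing a unit vector e1 orthogonal to Z, e2 and
J e2, all brackets of V that involve e2 or J e2 are central, the trace identity
kills the components of [e1, J e1] on e2 and J e2, and nilpotency kills those on
e1 and J e1 ([lie_adapted_central]). The trace identity for d in Z then gives
[e1, J e1] + [e2, J e2] = 0 ([adapted_trace]).

Thus every component of the bracket is a J-invariant 2-form on V of trace zero,
that is, an anti-self-dual form. With V = H, the quaternions, these are the forms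
(x, y) |-> l (Im (conj x * y)) with l linear on Im H, so the bracket is given by
a linear map L from Im H = R^3 to Z, and rotating the imaginary units amounts to
choosing an orthonormal basis of R^3. Such a basis can be adapted to the kernel
of L ([has_quat_frame_normal]). The rank of L, which is the dimension of the
derived algebra and hence an isomorphism invariant, is 3, 2 or 1, and g is then
g1, g2 or g3 respectively ([lie_isomorphic_model]). Rank 0 is excluded because g
is not abelian. *)

Set Implicit Arguments.
Unset Strict Implicit.
Unset Printing Implicit Defensive.

Import Order.TTheory GRing.Theory Num.Theory.

Local Open Scope ring_scope.

(** * Linear algebra *)

Lemma eq_by_coord (K : fieldType) (V : vectType K) (x y : V) :
  (forall i, coord (vbasis fullv) i x = coord (vbasis fullv) i y) -> x = y.
Proof.
move=> xy; rewrite [x](coord_vbasis (memvf x)) [y](coord_vbasis (memvf y)).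
by apply: eq_bigr => i _; rewrite xy.
Qed.

(* An identity between linear combinations of vectors holds as soon as it holds
   for each coordinate, where it is an identity in the scalar field. *)
Ltac vring := apply: eq_by_coord => ?;
  rewrite ?(linearD, linearN, linearZ, linear0) /=; ring.

Section Subspaces.
Variables (K : fieldType) (V : vectType K).
Implicit Types (x : V) (s : seq V) (U : {vspace V}).

Lemma dim_addv_line x U : x \notin U -> \dim (<[x]> + U) = (\dim U).+1.
Proof.
move=> xU; have x0 : x != 0 by apply: contraNneq xU => ->; rewrite mem0v.
rewrite dimv_disjoint_sum ?dim_vline ?x0 //.
apply/eqP; rewrite -subv0; apply/subvP => _ /memv_capP[/vlineP[k ->]].
have [-> _|k0] := eqVneq k 0; first by rewrite scale0r mem0v.
by move=> kx; case/negP: xU; rewrite -[x](scalerK k0) rpredZ.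
Qed.

Lemma extend_basis U s :
  free s -> {subset s <= U} -> exists t, basis_of U (t ++ s).
Proof.
move=> s_free /span_subvP sU; exists (vbasis (U :\: <<s>>)%VS).
have UE : (U :\: <<s>> + <<s>>)%VS = U by rewrite addv_diff; apply/addv_idPl.
rewrite -[U in basis_of U]UE cat_basis ?vbasisP //.
  by apply/directv_addP; rewrite capv_diff.
by rewrite /basis_of eqxx.
Qed.

Lemma mem_span4 (e1 e2 e3 e4 x : V) : x \in <<[:: e1; e2; e3; e4]>>%VS ->
  exists a1 a2 a3 a4, x = a1 *: e1 + a2 *: e2 + a3 *: e3 + a4 *: e4.
Proof.
rewrite !span_cons span_nil addv0.
case/memv_addP => _ /vlineP[a1 ->] [w1 + ->].
case/memv_addP => _ /vlineP[a2 ->] [w2 + ->].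
case/memv_addP => _ /vlineP[a3 ->] [w3 /vlineP[a4 ->] ->].
by exists a1, a2, a3, a4; rewrite !addrA.
Qed.

Lemma not_free3 (A B C : V) : ~~ free [:: A; B; C] ->
  exists a b c, (a, b, c) != (0, 0, 0) /\ a *: A + b *: B + c *: C = 0.
Proof.
rewrite !free_cons nil_free andbT !span_cons span_nil !addv0 memv0.
rewrite -!negb_or negbK.
case/orP => [/memv_addP[_ /vlineP[b ->] [_ /vlineP[c ->] ->]] |].
  exists 1, (- b), (- c); rewrite !xpair_eqE oner_eq0; split=> //; vring.
case/orP => [/vlineP[c ->]|/eqP->].
  exists 0, 1, (- c); rewrite !xpair_eqE oner_eq0 andbF; split=> //; vring.
by exists 0, 0, 1; rewrite !xpair_eqE oner_eq0 !andbF; split=> //; vring.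
Qed.

End Subspaces.

Section InnerProduct.
Variables (R : realType) (V : vectType R) (ip : {dot V for idfun}).
Implicit Types (c : R) (x y z : V).

Lemma ipC x y : ip x y = ip y x.
Proof. by rewrite hermC expr0 mul1r. Qed.
Lemma ipDr x y z : ip x (y + z) = ip x y + ip x z.
Proof. by rewrite (linearDr ip). Qed.
Lemma ipDl x y z : ip (x + y) z = ip x z + ip y z.
Proof. by rewrite !(ipC _ z) ipDr. Qed.
Lemma ip0l x : ip 0 x = 0.
Proof. by rewrite ipC linear0. Qed.
Lemma ipNr x y : ip x (- y) = - ip x y.
Proof. by rewrite (linearNr ip). Qed.
Lemma ipZr c x y : ip x (c *: y) = c * ip x y.
Proof. by rewrite linearZr. Qed.
Lemma ipZl c x y : ip (c *: x) y = c * ip x y.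
Proof. by rewrite ipC ipZr ipC. Qed.
Lemma ipNl x y : ip (- x) y = - ip x y.
Proof. by rewrite ipC ipNr ipC. Qed.

Lemma ip_unit_scale (x : V) : x != 0 -> exists c, ip (c *: x) (c *: x) = 1.
Proof.
move=> x0; exists (Num.sqrt (ip x x))^-1.
have xx_gt0 : 0 < ip x x := @neq0_dnorm_gt0 _ _ _ ip x x0.
rewrite ipZl ipZr mulrA -expr2 exprVn sqr_sqrtr ?ltW //.
by rewrite mulVf // gt_eqF.
Qed.

(** Each orthogonality condition cuts out a subspace of codimension at most 1. *)
Lemma unit_orthogonal (W : {vspace V}) (s : seq V) : (size s < \dim W)%N ->
  exists x, [/\ x \in W, ip x x = 1 & {in s, forall u, ip x u = 0}].
Proof.
elim: s W => [|u s IHs] W /= s_lt.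
  have : vpick W != 0 by rewrite vpick0 -dimv_eq0 -lt0n.
  case/ip_unit_scale => c c1; exists (c *: vpick W).
  by rewrite rpredZ ?memv_pick.
have [|x [xWu x1 xs]] := IHs (W :&: orthov ip <[u]>)%VS.
  apply: leq_trans (leq_dim_orthov1 ip u W).
  by rewrite -ltnS prednK // (leq_trans _ s_lt).
exists x; move: xWu; rewrite memv_cap mem_orthov1 => /andP[xW /eqP xu].
split=> //.
by move=> v; rewrite inE => /orP[/eqP-> | /xs].
Qed.

Lemma orthogonal_addv (x v : V) (U : {vspace V}) : ip x v = 0 ->
  {in U, forall u, ip x u = 0} -> {in (<[v]> + U)%VS, forall u, ip x u = 0}.
Proof.
move=> xv xU _ /memv_addP[_ /vlineP[k ->] [u uU ->]].
by rewrite ipDr ipZr xv xU // mulr0 addr0.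
Qed.

Lemma dim_addv_orthogonal (x : V) (U : {vspace V}) : ip x x = 1 ->
  {in U, forall u, ip x u = 0} -> \dim (<[x]> + U) = (\dim U).+1.
Proof.
move=> x1 xU; rewrite dim_addv_line //.
by apply/negP => /xU /eqP; rewrite x1 oner_eq0.
Qed.

End InnerProduct.

(** Polar coordinates, for which square roots are needed; s is the radius. *)
Lemma unit_direction (R : rcfType) (a b : R) :
  exists p q s, [/\ p ^+ 2 + q ^+ 2 = 1, a = p * s, b = q * s
    & (s == 0) = ((a, b) == (0, 0))].
Proof.
pose s := Num.sqrt (a ^+ 2 + b ^+ 2).
have ab_ge0 : 0 <= a ^+ 2 + b ^+ 2 by rewrite addr_ge0 ?sqr_ge0.
have s2 : s ^+ 2 = a ^+ 2 + b ^+ 2 by rewrite sqr_sqrtr.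
have s0E : (s == 0) = ((a, b) == (0, 0)).
  by rewrite -sqrf_eq0 s2 paddr_eq0 ?sqr_ge0 // !sqrf_eq0.
have [s0|s_neq0] := eqVneq s 0.
  have := s0E; rewrite s0 eqxx => /esym/eqP[-> ->].
  by exists 1, 0, 0; rewrite !mulr0 expr0n expr1n addr0 !eqxx.
exists (a / s), (b / s), s; rewrite !divfK //; split=> //.
by rewrite !expr_div_n -mulrDl -s2 divff // sqrf_eq0.
Qed.

(** * The powers of a 2-form *)

(** A permutation of n + 1 letters is the image of the first one followed by a
permutation of the others. *)
Lemma sum_perm_lift (M : nmodType) n (G : 'S_n.+1 -> M) :
  \sum_s G s = \sum_i \sum_(t : 'S_n) G (lift_perm ord0 i t).
Proof.
rewrite (partition_big (fun s : 'S_n.+1 => s ord0) predT) //=.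
apply: eq_bigr => i _; rewrite (reindex (lift_perm ord0 i)); last first.
  pose ulsf i (s : 'S_n.+1) k := odflt k (unlift (s i) (s (lift i k))).
  have ulsfK j (s : 'S_n.+1) k : lift (s j) (ulsf j s k) = s (lift j k).
    rewrite /ulsf; have:= neq_lift j k.
    by rewrite -(can_eq (permK s)) => /unlift_some[] ? ? ->.
  have inj_ulsf : injective (ulsf ord0 _).
    move=> s; apply: can_inj (ulsf (s ord0) s^-1%g) _ => k'.
    by rewrite {1}/ulsf ulsfK !permK liftK.
  exists (fun s => perm (inj_ulsf s)) => [s _ | s].
    by apply/permP=> k'; rewrite permE /ulsf lift_perm_lift lift_perm_id liftK.
  move/(s _ =P _) => si0; apply/permP=> k.
  case: (unliftP ord0 k) => [k'|] ->; rewrite ?lift_perm_id //.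
  by rewrite lift_perm_lift -si0 permE ulsfK.
by apply: eq_bigl => t; rewrite lift_perm_id eqxx.
Qed.

Lemma sign_lift_perm (R : pzRingType) n (i : 'I_n.+1) (t : 'S_n) :
  (-1) ^+ (lift_perm ord0 i t) = (-1) ^+ i * (-1) ^+ t :> R.
Proof. by rewrite odd_lift_perm /= signr_addb signr_odd. Qed.

Section Wedge.
Variables (R : numFieldType) (V : vectType R).

(** Equivariance under permutations is the only part of being an alternating
multilinear form that the expansion of a wedge product uses. *)
Definition alternates k (b : form V k) : Prop :=
  forall (v : 'I_k -> V) (t : 'S_k), b (v \o t) = (-1) ^+ t * b v.

(** A form could a priori tell apart two pointwise equal families of vectors. *)
Definition form_ext k (b : form V k) : Prop :=
  forall v w : 'I_k -> V, v =1 w -> b v = b w.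

Lemma eq_wedge p q (a : form V p) (b : form V q) :
  form_ext a -> form_ext b -> form_ext (wedge a b).
Proof.
move=> ea eb v w vw; congr (_ * _); apply: eq_bigr => s _.
by congr (_ * (_ * _)); [apply: ea | apply: eb] => i.
Qed.

(** The sum over all permutations makes any wedge product alternate. *)
Lemma wedge_alternates p q (a : form V p) (b : form V q) :
  form_ext a -> form_ext b -> alternates (wedge a b).
Proof.
move=> ea eb v t; rewrite /wedge mulrCA; congr (_ * _); rewrite mulr_sumr.
rewrite (reindex_inj (mulIg t^-1%g)) /=; apply: eq_bigr => s _.
rewrite odd_permM odd_permV signr_addb -mulrA mulrCA; congr (_ * (_ * _)).
by congr (_ * _); [apply: ea | apply: eb] => i; rewrite /= permM permKV.
Qed.

(** Splitting off the images i and lift i j of the first two indices, the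
remaining q! permutations all contribute the same amount since b alternates. *)
Lemma wedge2E q (a : form V 2) (b : form V q) (v : 'I_(2 + q) -> V) :
  form_ext a -> form_ext b -> alternates b ->
  wedge a b v = 2^-1 * \sum_(i < q.+2) \sum_(j < q.+1)
    (-1) ^+ (i + j) * (a (vpair (v i) (v (lift i j))) *
                       b (fun k => v (lift i (lift j k)))).
Proof.
move=> ea eb alt_b; rewrite /wedge natrM invfM -mulrA; congr (_ * _).
rewrite sum_perm_lift mulr_sumr; apply: eq_bigr => i _.
rewrite sum_perm_lift mulr_sumr; apply: eq_bigr => j _.
rewrite (eq_bigr (fun=> (-1) ^+ (i + j) * (a (vpair (v i) (v (lift i j))) *
                       b (fun k => v (lift i (lift j k)))))); last first.
  move=> s _; rewrite !sign_lift_perm exprD -!mulrA; congr (_ * _).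
  congr (_ * _); rewrite mulrCA; congr (_ * _).
    apply: ea => k; rewrite /vpair /vcons.
    case: (unliftP ord0 k) => [k'|] ->; last first.
      rewrite (_ : lshift q (ord0 : 'I_2) = ord0 :> 'I_q.+2) ?lift_perm_id //.
      exact: val_inj.
    rewrite ord1.
    rewrite (_ : lshift q (lift ord0 ord0 : 'I_2)
                 = lift ord0 (ord0 : 'I_q.+1) :> 'I_q.+2); last exact: val_inj.
    by rewrite lift_perm_lift lift_perm_id.
  rewrite -[RHS](signrMK s) -alt_b.
  congr (_ * _); apply: eb => k /=.
  rewrite (_ : rshift 2 k = lift ord0 (lift ord0 k) :> 'I_q.+2); last first.
    exact: val_inj.
  by rewrite !lift_perm_lift.
rewrite sumr_const card_Sn -[X in _ * X]mulr_natl mulKf //.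
by rewrite pnatr_eq0 -lt0n fact_gt0.
Qed.

(** Indexing the vectors by nat makes [lift] compute, as [bump]. *)
Lemma wedge2_nat q (a : form V 2) (b : form V q) (x : nat -> V) :
  form_ext a -> form_ext b -> alternates b ->
  wedge a b (fun i => x i) = 2^-1 * \sum_(0 <= i < q.+2) \sum_(0 <= j < q.+1)
    (-1) ^+ (i + j) * (a (vpair (x i) (x (bump i j))) *
                       b (fun k => x (bump i (bump j k)))).
Proof.
move=> ea eb alt_b; rewrite wedge2E // big_mkord; congr (_ * _).
by apply: eq_bigr => i _; rewrite big_mkord.
Qed.

(** The Pfaffian of a skew 4 x 4 array. *)
Definition pf4 (f : V -> V -> R) x1 x2 x3 x4 : R :=
  f x1 x2 * f x3 x4 - f x1 x3 * f x2 x4 + f x1 x4 * f x2 x3.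

Section Powers.
Variable F : form V 2.
Let f x y := F (vpair x y).
Hypothesis F_ext : form_ext F.
Hypothesis f_skew : forall x y, f x y = - f y x.

Lemma wedge_pow_ext m : form_ext (wedge_pow F m).
Proof. by elim: m => // m IHm; apply: eq_wedge. Qed.

(** The power 0 is the constant 1, and the only permutation of 'I_0 is even. *)
Lemma wedge_pow_alternates m : alternates (wedge_pow F m).
Proof.
case: m => [|m] v t; last first.
  by apply: wedge_alternates => //; apply: wedge_pow_ext.
by rewrite [t](permS0) odd_perm1 mulr1.
Qed.

Lemma wedge_powS m (x : nat -> V) : wedge_pow F m.+1 (fun i => x i) =
  2^-1 * \sum_(0 <= i < (m * 2).+2) \sum_(0 <= j < (m * 2).+1)
    (-1) ^+ (i + j) * (f (x i) (x (bump i j)) *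
                       wedge_pow F m (fun k => x (bump i (bump j k)))).
Proof.
by apply: wedge2_nat; [| exact: wedge_pow_ext | exact: wedge_pow_alternates].
Qed.

Lemma wedge_pow1E (x : nat -> V) : wedge_pow F 1 (fun i => x i) = f (x 0) (x 1).
Proof.
rewrite wedge_powS unlock /= /bump /= !(addn0, add1n, add0n).
by rewrite (f_skew (x 1)); field.
Qed.

Lemma wedge_pow2E (x : nat -> V) : wedge_pow F 2 (fun i => x i) =
  2 * pf4 f (x 0) (x 1) (x 2) (x 3).
Proof.
rewrite wedge_powS; set b := wedge_pow F 1.
have bE i j : b (fun k => x (bump i (bump j k))) =
    f (x (bump i (bump j 0))) (x (bump i (bump j 1))).
  exact: (wedge_pow1E (fun n => x (bump i (bump j n)))).
rewrite unlock /= !bE /pf4 /bump /= !(addn0, add1n, add0n).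
rewrite (f_skew (x 1) (x 0)) (f_skew (x 2) (x 0)) (f_skew (x 2) (x 1)).
rewrite (f_skew (x 3) (x 0)) (f_skew (x 3) (x 1)) (f_skew (x 3) (x 2)).
by field.
Qed.

(** F^3 is 3! times the Pfaffian, expanded along its first row. *)
Lemma wedge_pow3E (x : nat -> V) : wedge_pow F 3 (fun i => x i) = 6 *
  (f (x 0) (x 1) * pf4 f (x 2) (x 3) (x 4) (x 5)
   - f (x 0) (x 2) * pf4 f (x 1) (x 3) (x 4) (x 5)
   + f (x 0) (x 3) * pf4 f (x 1) (x 2) (x 4) (x 5)
   - f (x 0) (x 4) * pf4 f (x 1) (x 2) (x 3) (x 5)
   + f (x 0) (x 5) * pf4 f (x 1) (x 2) (x 3) (x 4)).
Proof.
rewrite wedge_powS; set b := wedge_pow F 2.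
have bE i j := wedge_pow2E (fun n => x (bump i (bump j n))).
rewrite -/b /= in bE.
rewrite unlock /= !bE /pf4 /bump /= !(addn0, add1n, add0n).
rewrite (f_skew (x 1) (x 0)) (f_skew (x 2) (x 0)) (f_skew (x 2) (x 1)).
rewrite (f_skew (x 3) (x 0)) (f_skew (x 3) (x 1)) (f_skew (x 3) (x 2)).
rewrite (f_skew (x 4) (x 0)) (f_skew (x 4) (x 1)) (f_skew (x 4) (x 2)).
rewrite (f_skew (x 4) (x 3)).
rewrite (f_skew (x 5) (x 0)) (f_skew (x 5) (x 1)) (f_skew (x 5) (x 2)).
rewrite (f_skew (x 5) (x 3)) (f_skew (x 5) (x 4)).
by field.
Qed.
End Powers.
End Wedge.

(** * The balanced condition on a unitary basis *)

Definition scons (T : Type) (y : T) (x : nat -> T) (n : nat) : T :=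
  if n is m.+1 then x m else y.

(** For i <= j the second index of the pair, lift i j, is j + 1. *)
Lemma ce_diff_nat (R : numFieldType) (g : lieAlgType R) k (a : form g k.+1)
    (x : nat -> g) :
  form_ext a ->
  ce_diff a (fun i => x i) =
  \sum_(0 <= i < k.+2) \sum_(0 <= j < k.+1 | (i <= j)%N) (-1) ^+ (i + j.+1) *
    a (fun l => scons [< x i, x j.+1 >] (fun l => x (bump i (bump j l))) l).
Proof.
move=> ea; rewrite /ce_diff big_mkord; apply: eq_bigr => i _.
rewrite big_mkord; apply: eq_bigr => j lij.
have -> : lift i j = j.+1 :> nat by rewrite /= /bump lij.
congr (_ * _); apply: ea => l; rewrite /vcons.
by case: (unliftP ord0 l) => [l'|] ->.
Qed.

Lemma vpairE (R : numFieldType) (V : vectType R) (x y : V) :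
  vpair x y ord0 = x /\ vpair x y ord_max = y.
Proof.
rewrite /vpair /vcons unlift_none; split=> //.
have -> : ord_max = lift ord0 (ord0 : 'I_1) by exact: val_inj.
by rewrite liftK.
Qed.

Section Hermitian.
Variables (R : realType) (g : lieAlgType R) (J : 'End(g)).
Variable ip : {dot g for idfun}.
Hypothesis JJ : forall x, J (J x) = - x.
Hypothesis ipJ : forall x y, ip (J x) (J y) = ip x y.

Lemma ipJl x y : ip (J x) y = - ip x (J y).
Proof. by rewrite -[LHS]ipJ JJ ipNl. Qed.

Lemma ipxJ x : ip x (J x) = 0.
Proof.
by have /eqP := ipJl x x; rewrite ipC -addr_eq0 -mulr2n mulrn_eq0 => /eqP.
Qed.

Lemma fundamental_ext : form_ext (fundamental_form J ip).
Proof. by move=> v w vw; rewrite /fundamental_form !vw. Qed.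

Lemma fundamental_vpair x y : fundamental_form J ip (vpair x y) = ip x (J y).
Proof. by rewrite /fundamental_form !(vpairE _ _).1 !(vpairE _ _).2. Qed.

(** Evaluate d(F^3) = 0 on (a, J a, b, J b, c, J c, d). The term of a pair of
arguments is F^3 of their bracket and of the five other ones. Unless these five
contain two complete pairs u, J u, the Pfaffian vanishes by orthogonality. What
remains is (u, J u), which leaves the component of [u, J u] on J d, and (u, d)
and (J u, d), which leave the diagonal entries of ad d on u and J u. *)
Lemma balanced_frame a b c d :
    \dim {:g} = 8%N -> balanced J ip ->
    {in [:: a; b; c], forall x, ip x x = 1} ->
    (ip a b = 0 /\ ip a (J b) = 0) -> (ip a c = 0 /\ ip a (J c) = 0) ->
    (ip a d = 0 /\ ip a (J d) = 0) -> (ip b c = 0 /\ ip b (J c) = 0) ->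
    (ip b d = 0 /\ ip b (J d) = 0) -> (ip c d = 0 /\ ip c (J d) = 0) ->
  \sum_(u <- [:: a; b; c])
    (ip [< u, J u >] (J d) + ip [< u, d >] u + ip [< J u, d >] (J u)) = 0.
Proof.
move=> dim8; rewrite /balanced dim8 => bal unit [ab abJ] [ac acJ] [ad adJ].
move=> [bc bcJ] [bd bdJ] [cd cdJ].
set F := fundamental_form J ip in bal.
have Fskew x y : F (vpair x y) = - F (vpair y x).
  by rewrite /F !fundamental_vpair -ipJl ipC.
have Fext := fundamental_ext.
have : ce_diff (wedge_pow F 3)
  (fun i => nth 0 [:: a; J a; b; J b; c; J c; d] i) = 0 := bal _.
rewrite (@ce_diff_nat _ _ 5 (wedge_pow F 3)); last first.
  exact: (wedge_pow_ext Fext (m := 3)).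
set W := wedge_pow F 3.
(* Making f opaque keeps the inner product out of the 21 expanded Pfaffians. *)
have [f fE] : exists f : g -> g -> R, forall u v, f u v = ip u (J v).
  by exists (fun u v => ip u (J v)).
have WE (x : nat -> g) : W (fun i => x i) = 6 *
    (f (x 0) (x 1) * pf4 f (x 2) (x 3) (x 4) (x 5)
     - f (x 0) (x 2) * pf4 f (x 1) (x 3) (x 4) (x 5)
     + f (x 0) (x 3) * pf4 f (x 1) (x 2) (x 4) (x 5)
     - f (x 0) (x 4) * pf4 f (x 1) (x 2) (x 3) (x 5)
     + f (x 0) (x 5) * pf4 f (x 1) (x 2) (x 3) (x 4)).
  by rewrite [LHS](wedge_pow3E Fext Fskew) /pf4 /F !fundamental_vpair -!fE.
set x := nth 0 [:: a; J a; b; J b; c; J c; d].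
rewrite unlock /= !WE {WE} /bump /= !(addn0, add1n, add0n) /x /= /pf4.
have fJJ u v : f (J u) (J v) = f u v by rewrite !fE ipJ.
have fJl u v : f (J u) v = ip u v by rewrite fE ipJ.
have fJr u v : f u (J v) = - ip u v by rewrite fE JJ ipNr.
have fxx u : f u u = 0 by rewrite fE ipxJ.
rewrite -!fE in abJ acJ adJ bcJ bdJ cdJ.
rewrite !fJJ !fJl !fJr !(fxx, abJ, acJ, adJ, bcJ, bdJ, cdJ).
rewrite !(ab, ac, ad, bc, bd, cd) !unit ?inE ?eqxx ?orbT // !fE => sum0.
(* Each surviving Pfaffian is a component up to sign, whence the factor 3!. *)
apply: (@mulfI _ (6 : R)); first by rewrite pnatr_eq0.
rewrite mulr0 -[RHS]oppr0 -[in RHS]sum0.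
ring.
Qed.

End Hermitian.

(** * Lie algebras and their derived algebra *)

Section Bracket.
Variables (R : fieldType) (g : lieAlgType R).
Implicit Types x y z : g.

Lemma lieDl x y z : [< x + y, z >] = [< x, z >] + [< y, z >].
Proof. by rewrite linearDl. Qed.
Lemma lieDr x y z : [< z, x + y >] = [< z, x >] + [< z, y >].
Proof. by rewrite linearD. Qed.
Lemma lieZl a x y : [< a *: x, y >] = a *: [< x, y >].
Proof. by rewrite linearZl_LR. Qed.
Lemma lieZr a x y : [< x, a *: y >] = a *: [< x, y >].
Proof. by rewrite linearZ. Qed.
Lemma lieNl x y : [< - x, y >] = - [< x, y >].
Proof. by rewrite linearNl. Qed.
Lemma lieNr x y : [< x, - y >] = - [< x, y >].
Proof. by rewrite linearN. Qed.
Lemma lieC x y : [< x, y >] = - [< y, x >].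
Proof.
apply/eqP; rewrite -addr_eq0; apply/eqP.
by have := liexx (x + y); rewrite lieDl !lieDr !liexx add0r addr0.
Qed.

Lemma center_liel z x : z \in center g -> [< z, x >] = 0.
Proof. by move/memv_center. Qed.
Lemma center_lier z x : z \in center g -> [< x, z >] = 0.
Proof. by move=> zZ; rewrite lieC center_liel ?oppr0. Qed.

End Bracket.

Definition derived (R : fieldType) (g : lieAlgType R) : {vspace g} :=
  lie_prod fullv fullv.

Section Isomorphism.
Variable R : fieldType.
Implicit Types g h : lieAlgType R.

Lemma lie_isomorphic_sym g h : lie_isomorphic g h -> lie_isomorphic h g.
Proof.
case=> f [f' fK f'K] fM.
have f'L : linear f'.
  by move=> a x y; apply: (can_inj fK); rewrite linearP !f'K.
pose f'l : {linear h -> g} := HB.pack f' (GRing.isLinear.Build R h g _ f' f'L).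
exists f'l; first by exists f.
by move=> x y; apply: (can_inj fK); rewrite fM !f'K.
Qed.

Lemma lie_isomorphic_inv g h (phi : h -> g) :
  linear phi -> bijective phi -> {morph phi : x y / [< x, y >]} ->
  lie_isomorphic g h.
Proof.
move=> phiL phi_bij phiM; apply: lie_isomorphic_sym.
pose phi_lin := GRing.isLinear.Build R h g _ phi phiL.
by pose phil : {linear h -> g} := HB.pack phi phi_lin; exists phil.
Qed.

Lemma derived_subP g (U : {vspace g}) :
  (forall x y, [< x, y >] \in U) <-> (derived g <= U)%VS.
Proof.
split=> [sub | /subvP sub x y]; last by rewrite sub ?memv_lie_prod ?memvf.
by apply/span_subvP => _ /allpairsP[[x y] [_ _ ->]].
Qed.

Lemma dim_derived_iso g h :
  lie_isomorphic g h -> \dim (derived g) = \dim (derived h).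
Proof.
wlog suff: g h / lie_isomorphic g h -> (\dim (derived g) <= \dim (derived h))%N.
  move=> le iso; apply/eqP; rewrite eqn_leq !le //; exact: lie_isomorphic_sym.
case=> f /bij_inj f_inj fM.
have f_ker : lker (linfun f) == 0%VS.
  by apply/lker0P => x y; rewrite !lfunE; exact: f_inj.
rewrite -(limg_dim_eq (f := linfun f)) ?(eqP f_ker) ?capv0 //.
apply/dimvS/subvP => _ /memv_imgP[u uD ->].
rewrite memv_preim; move: u uD; apply/subvP/derived_subP => x y.
by rewrite -memv_preim lfunE fM memv_lie_prod ?memvf.
Qed.

End Isomorphism.

Section Nilpotent.
Variables (R : fieldType) (g : lieAlgType R).
Hypothesis nil_g : nilpotent g.

(** Such a vector lies in every term of the lower central series. *)
Lemma nilpotent_eigenvector (x y : g) c :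
  c != 0 -> [< x, y >] = c *: y -> y = 0.
Proof.
move=> c_neq0 xy; case: nil_g => k k0; apply/eqP; rewrite -memv0 -k0.
elim: k {k0} => [|k IHk]; first exact: memvf.
rewrite -[y](scalerK c_neq0) -xy rpredZ // memv_lie_prod //; exact: memvf.
Qed.

(** The last term of the lower central series outside the center works. *)
Lemma second_center : ~~ (fullv <= center g)%VS ->
  exists2 x, x \notin center g & forall y, [< x, y >] \in center g.
Proof.
move=> not_abelian.
have ex_k : exists k, (lower_central g k <= center g)%VS.
  by case: nil_g => k k0; exists k; rewrite k0 sub0v.
case: (ex_minnP ex_k) => -[|k] kZ k_min; first by rewrite kZ in not_abelian.
have : ~~ (lower_central g k <= center g)%VS.
  by apply/negP => /k_min; rewrite ltnn.
case/subvPn => x xk xZ; exists x => // y.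
by rewrite lieC rpredN (subvP kZ) // memv_lie_prod ?memvf.
Qed.

End Nilpotent.

(** * Quaternionic frames *)

Section Frame.
Variables (R : fieldType) (g : lieAlgType R).
Implicit Types (e A B C x y z : g).

(** Modulo the center, e1, ..., e4 stand for the units 1, i, j, k of the
quaternions, and [x, y] = - L (Im (conj x * y)) where L sends i, j, k to A, B, C.
The sign makes A, B, C the basis vectors e_6, e_7, e_8 of g1. *)
Definition quat_frame e1 e2 e3 e4 A B C : Prop :=
  [/\ (fullv <= <<[:: e1; e2; e3; e4]>> + center g)%VS,
      [/\ A \in center g, B \in center g & C \in center g],
      [< e1, e2 >] = - A /\ [< e3, e4 >] = A,
      [< e1, e3 >] = - B /\ [< e2, e4 >] = - B
    & [< e1, e4 >] = - C /\ [< e2, e3 >] = C].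

Lemma quat_frame_lie e1 e2 e3 e4 A B C z w :
  quat_frame e1 e2 e3 e4 A B C -> z \in center g -> w \in center g ->
  forall a1 a2 a3 a4 b1 b2 b3 b4,
  [< a1 *: e1 + a2 *: e2 + a3 *: e3 + a4 *: e4 + z,
     b1 *: e1 + b2 *: e2 + b3 *: e3 + b4 *: e4 + w >] =
  - (a1 * b2 - a2 * b1 - (a3 * b4 - a4 * b3)) *: A
  - (a1 * b3 - a3 * b1 + (a2 * b4 - a4 * b2)) *: B
  - (a1 * b4 - a4 * b1 - (a2 * b3 - a3 * b2)) *: C.
Proof.
case=> _ _ [e12 e34] [e13 e24] [e14 e23] zZ wZ a1 a2 a3 a4 b1 b2 b3 b4.
rewrite !(lieDl, lieDr, lieZl, lieZr) !liexx.
rewrite !(center_liel _ zZ) !(center_lier _ wZ).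
rewrite (lieC e2 e1) (lieC e3 e1) (lieC e4 e1) (lieC e3 e2) (lieC e4 e2).
rewrite (lieC e4 e3) e12 e13 e14 e23 e24 e34.
vring.
Qed.

Lemma quat_frame_decomp e1 e2 e3 e4 A B C x : quat_frame e1 e2 e3 e4 A B C ->
  exists a1 a2 a3 a4 z, z \in center g /\
    x = a1 *: e1 + a2 *: e2 + a3 *: e3 + a4 *: e4 + z.
Proof.
case=> /subvP/(_ x (memvf x))/memv_addP[u uE [z zZ ->]] _ _ _ _.
by have [a1 [a2 [a3 [a4 ->]]]] := mem_span4 uE; exists a1, a2, a3, a4, z.
Qed.

Lemma quat_frame_derived e1 e2 e3 e4 A B C : quat_frame e1 e2 e3 e4 A B C ->
  derived g = <<[:: A; B; C]>>%VS.
Proof.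
move=> qf; apply/eqP; rewrite eqEsubv; apply/andP; split.
  apply/derived_subP => x y.
  have [a1 [a2 [a3 [a4 [z [zZ ->]]]]]] := quat_frame_decomp x qf.
  have [b1 [b2 [b3 [b4 [w [wZ ->]]]]]] := quat_frame_decomp y qf.
  rewrite (quat_frame_lie qf zZ wZ).
  by rewrite !rpredB ?rpredZ ?memv_span // !inE eqxx ?orbT.
case: qf => _ _ [_ e34] [_ e24] [_ e23]; apply/span_subvP => x.
rewrite !inE => /or3P[] /eqP->.
- by rewrite -e34 memv_lie_prod ?memvf.
- by rewrite -[B]opprK -e24 rpredN memv_lie_prod ?memvf.
- by rewrite -e23 memv_lie_prod ?memvf.
Qed.

(** Rotation of the imaginary units in the plane of i and j. *)
Lemma quat_frame_rotate e1 e2 e3 e4 A B C p q :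
  p ^+ 2 + q ^+ 2 = 1 -> quat_frame e1 e2 e3 e4 A B C ->
  quat_frame e1 (p *: e2 + q *: e3) (p *: e3 - q *: e2) e4
    (p *: A + q *: B) (p *: B - q *: A) C.
Proof.
move=> pq1 [full [AZ BZ CZ] [e12 e34] [e13 e24] [e14 e23]].
have e32 : [< e3, e2 >] = - C by rewrite lieC e23.
split.
- apply: subv_trans full _; apply: addvS; last exact: subvv.
  apply/span_subvP => x; rewrite !inE; set E := span _.
  have mE i : i \in [:: e1; p *: e2 + q *: e3; p *: e3 - q *: e2; e4] ->
      i \in E by exact: memv_span.
  case/or4P => /eqP ->; try by apply: mE; rewrite !inE eqxx ?orbT.
    rewrite (_ : e2 = p *: (p *: e2 + q *: e3) - q *: (p *: e3 - q *: e2)).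
      by rewrite rpredB // rpredZ // mE // !inE eqxx ?orbT.
    by rewrite -[LHS]scale1r -pq1; vring.
  rewrite (_ : e3 = q *: (p *: e2 + q *: e3) + p *: (p *: e3 - q *: e2)).
    by rewrite rpredD // rpredZ // mE // !inE eqxx ?orbT.
  by rewrite -[LHS]scale1r -pq1; vring.
- by split; rewrite ?rpredD ?rpredN ?rpredZ.
- by split; rewrite !(lieDl, lieDr, lieZl, lieZr, lieNl) ?e12 ?e13 ?e34 ?e24 //;
    vring.
- by split; rewrite !(lieDl, lieDr, lieZl, lieZr, lieNl, lieNr)
    ?e12 ?e13 ?e34 ?e24 //; vring.
- split=> //; rewrite !(lieDl, lieDr, lieZl, lieZr, lieNl, lieNr) !liexx.
  rewrite e23 e32.
  by rewrite -[in RHS](scale1r C) -pq1; vring.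
Qed.

(** Cyclic permutation of the imaginary units. *)
Lemma quat_frame_cycle e1 e2 e3 e4 A B C :
  quat_frame e1 e2 e3 e4 A B C -> quat_frame e1 e3 e4 e2 B C A.
Proof.
case=> full [AZ BZ CZ] [e12 e34] [e13 e24] [e14 e23]; split=> //.
- congr (_ <= _ + _)%VS : full; apply: eq_span => x; rewrite !inE.
  by rewrite !orbA; do 2 case: (x == e2) => //=; rewrite ?orbT ?orbF.
- by split=> //; rewrite lieC e24 opprK.
- by split=> //; rewrite lieC e23.
Qed.

Lemma quat_frame_basis e1 e2 e3 e4 A B C (s : 4.-tuple g) :
  \dim {:g} = 8%N -> quat_frame e1 e2 e3 e4 A B C -> basis_of (center g) s ->
  basis_of {:g} ([:: e1; e2; e3; e4] ++ s).
Proof.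
move=> dim8 [full _ _ _ _] sZ.
by rewrite basisEdim size_cat (size_tuple s) span_cat (span_basis sZ) full dim8.
Qed.

End Frame.

Section Normalise.
Variables (R : rcfType) (g : lieAlgType R).
Implicit Types (e A B C : g).

Definition has_quat_frame A B C : Prop :=
  exists e1 e2 e3 e4, quat_frame e1 e2 e3 e4 A B C.

Lemma has_quat_frame_cycle A B C : has_quat_frame A B C -> has_quat_frame B C A.
Proof.
by case=> e1 [e2 [e3 [e4 /quat_frame_cycle qf]]]; exists e1, e3, e4, e2.
Qed.

Lemma has_quat_frame_rotate A B C a b : has_quat_frame A B C ->
  exists A' B' s, [/\ has_quat_frame A' B' C, a *: A + b *: B = s *: A'
    & (s == 0) = ((a, b) == (0, 0))].
Proof.
case=> e1 [e2 [e3 [e4 qf]]].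
have [p [q [s [pq1 -> -> s0]]]] := unit_direction a b.
exists (p *: A + q *: B), (p *: B - q *: A), s; split=> //; last by vring.
by do 4 eexists; exact: quat_frame_rotate pq1 qf.
Qed.

(** A vanishing combination of A and B is rotated onto the first unit. *)
Lemma has_quat_frame_relation A B C a b : has_quat_frame A B C ->
  a *: A + b *: B = 0 -> (a, b) != (0, 0) -> exists B', has_quat_frame 0 B' C.
Proof.
move=> /(has_quat_frame_rotate a b)[A' [B' [s [qf -> <-]]]] /eqP.
by rewrite scaler_eq0 => /orP[-> // | /eqP A'0 _]; exists B'; rewrite -A'0.
Qed.

(** The units are rotated two at a time. For a relation between A, B and C, a
first rotation replaces A and B by their combination A1, a second one turns the
relation between C and A1 into the vanishing of the first vector, and if the
other two are still dependent a third rotation kills one of them. *)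
Lemma has_quat_frame_normal A B C : has_quat_frame A B C ->
  exists A' B' C', has_quat_frame A' B' C' /\
    [\/ free [:: A'; B'; C'], A' = 0 /\ free [:: B'; C'] | B' = 0 /\ C' = 0].
Proof.
move=> qf; have [fABC|] := boolP (free [:: A; B; C]).
  by exists A, B, C; split=> //; apply: Or31.
case/not_free3 => a [b [c [abc_neq0 abc0]]].
have [A1 [B1 [s [qf1 sA1 s0]]]] := has_quat_frame_rotate a b qf.
rewrite sA1 in abc0.
have [||B2 qf2] := has_quat_frame_relation (a := c) (b := s)
  (has_quat_frame_cycle (has_quat_frame_cycle qf1)).
- by rewrite addrC.
- by apply: contraNN abc_neq0; rewrite !xpair_eqE s0 xpair_eqE andbC.
have [fBC|] := boolP (free [:: B2; B1]).
  by exists 0, B2, B1; split=> //; apply: Or32.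
rewrite free_cons seq1_free span_seq1 -negb_or negbK => dep.
have [b' [c' [bc_neq0 bc0]]] : exists b' c' : R,
    (b', c') != (0, 0) /\ b' *: B2 + c' *: B1 = 0.
  case/orP: dep => [/vlineP[k ->] | /eqP ->].
    by exists 1, (- k); rewrite xpair_eqE oner_eq0; split=> //; vring.
  by exists 0, 1; rewrite xpair_eqE oner_eq0 andbF; split=> //; vring.
have [B3 qf3] := has_quat_frame_relation (has_quat_frame_cycle qf2) bc0 bc_neq0.
by exists B3, 0, 0; split; [exact: has_quat_frame_cycle | exact: Or33].
Qed.

End Normalise.

(** * The three model algebras *)

Section Comb.
Variables (K : fieldType) (V : vectType K).

Definition comb (s : seq V) (v : 'rV[K]_8) : V :=
  \sum_(i < 8) v 0 i *: s`_i.

Lemma comb_linear s : linear (comb s).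
Proof.
move=> a v w; rewrite scaler_sumr -big_split; apply: eq_bigr => i _ /=.
by rewrite !mxE scalerDl scalerA.
Qed.

Lemma comb_bijective (s : 8.-tuple V) : basis_of {:V} s -> bijective (comb s).
Proof.
move=> sb; exists (fun x => \row_i coord s i x) => [v | x].
  by apply/rowP => i; rewrite mxE coord_sum_free // (basis_free sb).
rewrite [RHS](coord_basis sb (memvf x)).
by apply: eq_bigr => i _; rewrite mxE.
Qed.

(** The last four terms form the central summand in [quat_frame_lie]. *)
Lemma combE s v : comb s v =
    v 0 (inord 0) *: s`_0 + v 0 (inord 1) *: s`_1 + v 0 (inord 2) *: s`_2
  + v 0 (inord 3) *: s`_3 + (v 0 (inord 4) *: s`_4 + v 0 (inord 5) *: s`_5
  + v 0 (inord 6) *: s`_6 + v 0 (inord 7) *: s`_7).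
Proof.
rewrite /comb (eq_bigr (fun i : 'I_8 => v 0 (inord i) *: s`_i)); last first.
  by move=> i _; rewrite inord_val.
rewrite -(big_mkord predT (fun i => v 0 (inord i) *: s`_i)) unlock /=.
by rewrite addr0 !addrA.
Qed.

Lemma memv_comb4 (U : {vspace V}) (s : 4.-tuple V) a b c d : basis_of U s ->
  a *: s`_0 + b *: s`_1 + c *: s`_2 + d *: s`_3 \in U.
Proof.
move=> sb; have sU i : (i < 4)%N -> s`_i \in U.
  by move=> i4; apply: (basis_mem sb); rewrite mem_nth ?size_tuple.
by rewrite !rpredD ?rpredZ ?sU.
Qed.

End Comb.

Section ModelIso.
Variables (R : numFieldType) (g : lieAlgType R).
Implicit Types e z : g.

(* In the basis e1, ..., e4, z5, ..., z8 the frame relations are the structure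
   equations of h. *)
Ltac solve_model_iso h :=
  match goal with |- _ -> is_true (basis_of _ [:: ?z5; ?z6; ?z7; ?z8]) ->
      quat_frame ?e1 ?e2 ?e3 ?e4 _ _ _ -> _ =>
    let zs := fresh in pose zs := [tuple z5; z6; z7; z8];
    let dim8 := fresh in let zb := fresh in let qf := fresh in
    move=> dim8 zb qf;
    have := quat_frame_basis (s := zs) dim8 qf zb;
    let sb := fresh in move=> sb;
    apply: (@lie_isomorphic_inv _ _ h (comb ([:: e1; e2; e3; e4] ++ zs)));
    [ exact: comb_linear
    | exact: (comb_bijective (s := [tuple e1; e2; e3; e4; z5; z6; z7; z8]))
    | let v := fresh in let w := fresh in move=> v w;
      rewrite !combE (quat_frame_lie qf); try exact: (memv_comb4 (s := zs));
      rewrite !lie_ofE !inordK //= !ee_vpair /=; vring ]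
  end.

Lemma quat_frame_iso_g1 e1 e2 e3 e4 z5 z6 z7 z8 :
  \dim {:g} = 8%N -> basis_of (center g) [:: z5; z6; z7; z8] ->
  quat_frame e1 e2 e3 e4 z6 z7 z8 -> lie_isomorphic g (g1 R).
Proof. solve_model_iso (g1 R). Qed.

Lemma quat_frame_iso_g2 e1 e2 e3 e4 z5 z6 z7 z8 :
  \dim {:g} = 8%N -> basis_of (center g) [:: z5; z6; z7; z8] ->
  quat_frame e1 e2 e3 e4 0 z7 z8 -> lie_isomorphic g (g2 R).
Proof. solve_model_iso (g2 R). Qed.

Lemma quat_frame_iso_g3 e1 e2 e3 e4 z5 z6 z7 z8 :
  \dim {:g} = 8%N -> basis_of (center g) [:: z5; z6; z7; z8] ->
  quat_frame e1 e2 e3 e4 z8 0 0 -> lie_isomorphic g (g3 R).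
Proof. solve_model_iso (g3 R). Qed.

End ModelIso.

Section ModelDerived.
Variable R : numFieldType.

Let d (k : nat) : 'rV[R]_8 := delta_mx 0 (inord k).

Let dE k l : (k < 8)%N -> (l < 8)%N -> d k 0 (inord l) = (l == k)%:R.
Proof. by move=> k8 l8; rewrite mxE eqxx -val_eqE /= !inordK. Qed.

Lemma row8P (x y : 'rV[R]_8) :
  (forall k, (k < 8)%N -> x 0 (inord k) = y 0 (inord k)) -> x = y.
Proof. by move=> xy; apply/rowP => k; rewrite -[k]inord_val xy. Qed.

Lemma free_d567 : free [:: d 5; d 6; d 7].
Proof.
suff: free [tuple d 5; d 6; d 7] by [].
apply/freeP => k.
rewrite !big_ord_recl big_ord0 /= addr0 => k0.
have kE l : (l < 8)%N ->
    k ord0 * (l == 5)%:R + (k (lift ord0 ord0) * (l == 6)%:R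
    + k (lift ord0 (lift ord0 ord0)) * (l == 7)%:R) = 0.
  by move=> l8; move/rowP/(_ (inord l)): k0; rewrite !mxE -!(dE _ l8) // !mxE.
move=> [[|[|[|//]]] i3].
- have := kE 5 isT; rewrite !mulr0 mulr1 !addr0 => <-.
  by congr k; exact: val_inj.
- have := kE 6 isT; rewrite !mulr0 mulr1 !addr0 !add0r => <-.
  by congr k; exact: val_inj.
- have := kE 7 isT; rewrite !mulr0 mulr1 !add0r => <-.
  by congr k; exact: val_inj.
Qed.

Ltac row8 := apply: row8P => -[|[|[|[|[|[|[|[|?]]]]]]]] // _;
  rewrite !mxE ?lie_ofE ?inordK //= ?ee_vpair ?mxE /= -?val_eqE /= ?inordK //=;
  ring.

Lemma dim_derived_g1 : \dim (derived (g1 R)) = 3.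
Proof.
rewrite -[RHS](eqP free_d567).
congr (\dim _); apply/eqP; rewrite eqEsubv; apply/andP; split.
  apply/derived_subP => x y; pose b := lie_of (@de_g1 R) x y.
  rewrite (_ : [< x, y >] = b 0 (inord 5) *: d 5 + b 0 (inord 6) *: d 6
                            + b 0 (inord 7) *: d 7).
    by rewrite ?rpredD // rpredZ // memv_span // !inE eqxx ?orbT.
  by rewrite -[LHS]/b /b; row8.
apply/span_subvP => u; rewrite !inE => /or3P[] /eqP->.
- rewrite (_ : d 5 = lie_of (@de_g1 R) (d 1) (d 0)); last by row8.
  exact: (@memv_lie_prod _ (g1 R) _ _ (d 1) (d 0) (memvf _) (memvf _)).
- rewrite (_ : d 6 = lie_of (@de_g1 R) (d 2) (d 0)); last by row8.
  exact: (@memv_lie_prod _ (g1 R) _ _ (d 2) (d 0) (memvf _) (memvf _)).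
- rewrite (_ : d 7 = lie_of (@de_g1 R) (d 3) (d 0)); last by row8.
  exact: (@memv_lie_prod _ (g1 R) _ _ (d 3) (d 0) (memvf _) (memvf _)).
Qed.

Lemma dim_derived_g2 : \dim (derived (g2 R)) = 2.
Proof.
rewrite -[RHS](eqP (catr_free (X := [:: d 5]) free_d567)).
congr (\dim _); apply/eqP; rewrite eqEsubv; apply/andP; split.
  apply/derived_subP => x y; pose b := lie_of (@de_g2 R) x y.
  rewrite (_ : [< x, y >] = b 0 (inord 6) *: d 6 + b 0 (inord 7) *: d 7).
    by rewrite ?rpredD // rpredZ // memv_span // !inE eqxx ?orbT.
  by rewrite -[LHS]/b /b; row8.
apply/span_subvP => u; rewrite !inE => /orP[] /eqP->.
- rewrite (_ : d 6 = lie_of (@de_g2 R) (d 2) (d 0)); last by row8.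
  exact: (@memv_lie_prod _ (g2 R) _ _ (d 2) (d 0) (memvf _) (memvf _)).
- rewrite (_ : d 7 = lie_of (@de_g2 R) (d 3) (d 0)); last by row8.
  exact: (@memv_lie_prod _ (g2 R) _ _ (d 3) (d 0) (memvf _) (memvf _)).
Qed.

Lemma dim_derived_g3 : \dim (derived (g3 R)) = 1.
Proof.
rewrite -[RHS](eqP (catr_free (X := [:: d 5; d 6]) free_d567)).
congr (\dim _); apply/eqP; rewrite eqEsubv; apply/andP; split.
  apply/derived_subP => x y; pose b := lie_of (@de_g3 R) x y.
  rewrite (_ : [< x, y >] = b 0 (inord 7) *: d 7).
    by rewrite ?rpredD // rpredZ // memv_span // !inE eqxx ?orbT.
  by rewrite -[LHS]/b /b; row8.
apply/span_subvP => u; rewrite !inE => /eqP->.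
rewrite (_ : d 7 = lie_of (@de_g3 R) (d 1) (d 0)); last by row8.
exact: (@memv_lie_prod _ (g3 R) _ _ (d 1) (d 0) (memvf _) (memvf _)).
Qed.

End ModelDerived.

(** The three cases are the possible ranks of L, and a basis of the center that
extends a basis of the image of L completes the frame to a basis of g. *)
Lemma lie_isomorphic_model (R : realType) (g : lieAlgType R) (A B C : g) :
  \dim {:g} = 8%N -> \dim (center g) = 4%N -> has_quat_frame A B C ->
  [\/ lie_isomorphic g (g1 R) /\ \dim (derived g) = 3%N,
      lie_isomorphic g (g2 R) /\ \dim (derived g) = 2%N
    | lie_isomorphic g (g3 R) /\ \dim (derived g) = 1%N].
Proof.
move=> dim8 dimZ /has_quat_frame_normal[{}A [{}B [{}C [+ cases]]]].
case=> e1 [e2 [e3 [e4 qf]]].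
have [AZ BZ CZ] : [/\ A \in center g, B \in center g & C \in center g].
  by case: qf.
have der := quat_frame_derived qf.
have extend (s : seq g) : free s -> {subset s <= center g} ->
    exists2 t, size t = (4 - size s)%N & basis_of (center g) (t ++ s).
  move=> s_free sZ; have [t tb] := extend_basis s_free sZ; exists t => //.
  by rewrite -dimZ (size_basis (X := in_tuple (t ++ s)) tb) size_cat addnK.
case: cases => [fABC | [A0 fBC] | [B0 C0]].
- have [t size_t tb] : exists2 t, size t = 1%N
      & basis_of (center g) (t ++ [:: A; B; C]).
    by apply: (extend [:: A; B; C]) => // x; rewrite !inE => /or3P[] /eqP->.
  case: t size_t tb => [|z5 [|? ?]] // _ tb; apply: Or31; split.
    exact: quat_frame_iso_g1 dim8 tb qf.
  by rewrite der (eqP fABC).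
- rewrite A0 in qf der.
  have [t size_t tb] : exists2 t, size t = 2%N
      & basis_of (center g) (t ++ [:: B; C]).
    by apply: (extend [:: B; C]) => // x; rewrite !inE => /orP[] /eqP->.
  case: t size_t tb => [|z5 [|z6 [|? ?]]] // _ tb; apply: Or32; split.
    exact: quat_frame_iso_g2 dim8 tb qf.
  by rewrite der span_cons add0v (eqP fBC).
rewrite B0 C0 in qf der.
have A0 : A != 0.
  apply/eqP => A0; have := dimZ; suff -> : center g = fullv by rewrite dim8.
  apply/eqP; rewrite eqEsubv subvf; apply/subvP => x _; apply/memv_center => y.
  have : [< x, y >] \in derived g by rewrite memv_lie_prod ?memvf.
  by rewrite der A0 !span_cons span_nil !addv0 memv0 => /eqP.
have [t size_t tb] : exists2 t, size t = 3%N
    & basis_of (center g) (t ++ [:: A]).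
  by apply: (extend [:: A]) => [|x]; rewrite ?seq1_free // inE => /eqP->.
case: t size_t tb => [|z5 [|z6 [|z7 [|? ?]]]] // _ tb; apply: Or33; split.
  exact: quat_frame_iso_g3 dim8 tb qf.
by rewrite der !span_cons span_nil !addv0 dim_vline A0.
Qed.

(** * The frame of an abelian balanced structure *)

Section Construction.
Variables (R : realType) (g : lieAlgType R) (J : 'End(g)).
Variable ip : {dot g for idfun}.
Hypotheses (dim8 : \dim {:g} = 8%N) (dimZ : \dim (center g) = 4%N).
Hypothesis nil_g : nilpotent g.
Hypothesis JJ : forall x, J (J x) = - x.
Hypothesis ipJ : forall x y, ip (J x) (J y) = ip x y.
Hypothesis abJ : forall x y, [< J x, J y >] = [< x, y >].
Hypothesis bal : balanced J ip.

Lemma lie_Jr x y : [< x, J y >] = - [< J x, y >].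
Proof. by rewrite -abJ JJ lieNr. Qed.

Lemma center_J x : x \in center g -> J x \in center g.
Proof.
move=> xZ; apply/memv_center => y.
by rewrite -[LHS]opprK -lie_Jr center_liel ?oppr0.
Qed.

(** A unitary basis of the orthogonal complement of the center is e1, J e1, e2,
J e2, with e2 in the second center. *)
Definition adapted_pair e1 e2 : Prop :=
  [/\ [/\ ip e1 e1 = 1, ip e2 e2 = 1, ip e1 e2 = 0 & ip e1 (J e2) = 0],
      {in center g, forall z, ip e1 z = 0 /\ ip e2 z = 0}
    & forall y, [< e2, y >] \in center g].

Lemma exists_adapted_pair : exists e1 e2, adapted_pair e1 e2.
Proof.
have [|x xZ x_lie] := second_center nil_g.
  by apply/negP => /dimvS; rewrite dim8 dimZ.
have dimxZ : \dim (<[x]> + center g) = 5%N by rewrite dim_addv_line ?dimZ.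
(* Only finitely many orthogonality conditions can be prescribed: test Z on a
   basis. *)
have perpZ (u : g) : {in (vbasis (center g) : seq g), forall z, ip u z = 0} ->
    {in center g, forall z, ip u z = 0}.
  move=> uZ z /coord_vbasis ->; rewrite linear_sumr big1 //= => i _.
  by rewrite ipZr uZ ?mulr0 // mem_nth // size_tuple.
have [|e2 [e2x e21 e2Z]] := unit_orthogonal ip (W := <[x]> + center g)
    (s := vbasis (center g)); first by rewrite size_tuple dimZ dimxZ.
have [|e1 [_ e11 e1Z]] := unit_orthogonal ip (W := fullv)
    (s := [:: e2, J e2 & vbasis (center g)]).
  by rewrite /= size_tuple dimZ dim8.
exists e1, e2; split; first by split; rewrite // e1Z // !inE eqxx ?orbT.
- move=> z zZ; split; apply: perpZ zZ => // u uZ.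
  by rewrite e1Z // !inE uZ !orbT.
- move=> y; case/memv_addP: e2x => _ /vlineP[k ->] [z zZ ->].
  by rewrite lieDl lieZl (center_liel _ zZ) addr0 rpredZ.
Qed.

Section AdaptedPair.
Variables e1 e2 : g.
Hypothesis adapted : adapted_pair e1 e2.

Let perp x := forall z, z \in center g -> ip x z = 0.

Let e11 : ip e1 e1 = 1. Proof. by case: adapted => -[]. Qed.
Let e22 : ip e2 e2 = 1. Proof. by case: adapted => -[]. Qed.
Let e12 : ip e1 e2 = 0. Proof. by case: adapted => -[]. Qed.
Let e1J2 : ip e1 (J e2) = 0. Proof. by case: adapted => -[]. Qed.
Let e1Z : perp e1. Proof. by case: adapted => _ perpZ _ z /perpZ[]. Qed.
Let e2Z : perp e2. Proof. by case: adapted => _ perpZ _ z /perpZ[]. Qed.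
Let lie_e2 y : [< y, e2 >] \in center g.
Proof. by case: adapted => _ _ e2_lie; rewrite lieC rpredN. Qed.
Let lie_Je2 y : [< y, J e2 >] \in center g.
Proof. by rewrite lie_Jr rpredN. Qed.

Let perpJ x : perp x -> perp (J x).
Proof. by move=> xZ z zZ; rewrite ipJl // xZ ?oppr0 ?center_J. Qed.

Let ip_perp x z : perp x -> z \in center g -> ip z x = 0.
Proof. by move=> xZ zZ; rewrite ipC xZ. Qed.

Lemma adapted_span :
  (<[e1]> + (<[J e1]> + (<[e2]> + (<[J e2]> + center g))))%VS = fullv.
Proof.
apply/eqP; rewrite eqEdim subvf dim8.
have J21 : ip (J e2) (J e2) = 1 by rewrite ipJ.
have J11 : ip (J e1) (J e1) = 1 by rewrite ipJ.
have J12 : ip (J e1) e2 = 0 by rewrite ipJl // e1J2 oppr0.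
have J1J2 : ip (J e1) (J e2) = 0 by rewrite ipJ.
by rewrite !(dim_addv_orthogonal (ip := ip)) ?dimZ //;
  do ?[apply: orthogonal_addv; rewrite ?ipxJ //];
  move=> z zZ; first [exact: e1Z | exact: e2Z | exact: perpJ e1Z _ zZ
                     | exact: perpJ e2Z _ zZ].
Qed.

(** The trace identity at d, on e1 and a unitary pair of central vectors: every
term but the first one vanishes or tests a bracket in Z against e1 or J e1. *)
Lemma lie_adapted_orthogonal d : perp d -> (forall y, [< y, d >] \in center g) ->
  ip e1 d = 0 -> ip e1 (J d) = 0 -> ip [< e1, J e1 >] (J d) = 0.
Proof.
move=> dZ lie_d e1d e1Jd.
have [|e3 [e3Z e33 _]] := unit_orthogonal ip (W := center g) (s := [::]).
  by rewrite dimZ.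
have [|e4 [e4Z e44 e4_3]] := unit_orthogonal ip (W := center g)
  (s := [:: e3; J e3]); first by rewrite dimZ.
have := balanced_frame JJ ipJ (a := e1) (b := e3) (c := e4) (d := d) dim8 bal.
rewrite !big_cons big_nil !(center_liel _ e3Z, center_liel _ e4Z).
rewrite !(center_liel _ (center_J e3Z), center_liel _ (center_J e4Z)).
rewrite !ip0l !addr0 [ip [< e1, d >] _]ipC [ip [< J e1, d >] _]ipC.
rewrite (e1Z (lie_d _)) (perpJ e1Z (lie_d _)) !addr0; apply.
- by move=> x; rewrite !inE => /or3P[] /eqP->.
- by split; apply: e1Z; rewrite ?center_J.
- by split; apply: e1Z; rewrite ?center_J.
- by [].
- split; first by rewrite ipC e4_3 // inE eqxx.
  by apply: oppr_inj; rewrite -ipJl // ipC e4_3 ?oppr0 // !inE eqxx orbT.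
- by split; apply: ip_perp => //; exact: perpJ.
- by split; apply: ip_perp => //; exact: perpJ.
Qed.

(** Only components on e1 and J e1 can be left modulo the center, and if one of
them is nonzero the bracket is an eigenvector of ad (J e1) or ad e1 for a nonzero
eigenvalue. *)
Lemma lie_adapted_central : [< e1, J e1 >] \in center g.
Proof.
set w := [< e1, J e1 >].
have we2 : ip w e2 = 0.
  apply: oppr_inj; rewrite -ipNr -JJ oppr0; apply: lie_adapted_orthogonal => //.
  - exact: perpJ.
  - by rewrite JJ ipNr e12 oppr0.
have wJe2 : ip w (J e2) = 0 by exact: lie_adapted_orthogonal.
have [a1 [a2 [z [zZ wE]]]] : exists a1 a2 z,
    z \in center g /\ w = a1 *: e1 + a2 *: J e1 + z.
  have := memvf w; rewrite -adapted_span.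
  case/memv_addP => _ /vlineP[a1 ->] [u1 u1E wE].
  case/memv_addP: u1E wE => _ /vlineP[a2 ->] [u2 u2E ->] wE.
  case/memv_addP: u2E wE => _ /vlineP[a3 ->] [u3 u3E ->] wE.
  case/memv_addP: u3E wE => _ /vlineP[a4 ->] [z zZ ->] wE.
  exists a1, a2, z; split=> //; rewrite wE.
  have e2J1 : ip e2 (J e1) = 0 by rewrite ipC ipJl // e1J2 oppr0.
  have e21 : ip e2 e1 = 0 by rewrite ipC.
  have a30 : a3 = 0.
    move: we2; rewrite ipC wE !(ipDr, ipZr) e21 e2J1 e22 ipxJ // e2Z //.
    by rewrite !mulr0 mulr1 !add0r !addr0.
  have a40 : a4 = 0.
    move: wJe2; rewrite ipC wE !(ipDr, ipZr) ipJ !(ipJl JJ ipJ) ?ipJ.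
    rewrite JJ ipNr e22 e21 e2J1 ipxJ // (e2Z (center_J zZ)) //.
    by rewrite !(oppr0, mulr0) opprK mulr1 !add0r !addr0.
  by rewrite a30 a40 !scale0r !add0r addrA.
have [a20|a20] := eqVneq a2 0; last first.
  (* w is an eigenvector of ad e1 for the eigenvalue a2. *)
  rewrite (nilpotent_eigenvector nil_g (x := e1) (y := w) a20) ?mem0v //.
  by rewrite {1}wE !(lieDr, lieZr) liexx (center_lier _ zZ) scaler0 add0r addr0.
have [a10|a10] := eqVneq a1 0; last first.
  rewrite (nilpotent_eigenvector nil_g (x := J e1) (y := w) (c := - a1))
    ?mem0v ?oppr_eq0 //.
  rewrite {1}wE !(lieDr, lieZr) liexx (center_lier _ zZ) scaler0 !addr0.
  by rewrite lieC scalerN scaleNr.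
by rewrite wE a10 a20 !scale0r !add0r.
Qed.

(** Otherwise the sum v would be a nonzero central vector, and the trace
identity at a multiple d of J v says that v is orthogonal to J d, hence to
itself. *)
Lemma adapted_trace : [< e2, J e2 >] = - [< e1, J e1 >].
Proof.
apply/eqP; rewrite -addr_eq0 addrC; set v := _ + _.
have vZ : v \in center g by rewrite rpredD ?lie_adapted_central.
apply: contraTT isT => v0.
have [c c1] : exists c, ip (c *: J v) (c *: J v) = 1.
  apply: ip_unit_scale; apply: contraNneq v0 => Jv0.
  by rewrite -oppr_eq0 -JJ Jv0 linear0.
have dZ : c *: J v \in center g by rewrite rpredZ ?center_J.
have Jd : J (c *: J v) = - (c *: v) by rewrite linearZ /= JJ scalerN.
move: (c *: J v) c1 dZ Jd => d d1 dZ Jd.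
have [|e3 [e3Z e33 e3_4]] := unit_orthogonal ip (W := center g)
  (s := [:: d; J d]); first by rewrite dimZ.
have vJd : ip v (J d) = 0.
  have := balanced_frame JJ ipJ (a := e1) (b := e2) (c := e3) (d := d) dim8 bal.
  rewrite !big_cons big_nil !(center_liel _ e3Z) !(center_lier _ dZ).
  rewrite !ip0l !addr0 -ipDl -/v; apply.
  - by move=> x; rewrite !inE => /or3P[] /eqP->.
  - by [].
  - by split; apply: e1Z; rewrite ?center_J.
  - by split; apply: e1Z; rewrite ?center_J.
  - by split; apply: e2Z; rewrite ?center_J.
  - by split; apply: e2Z; rewrite ?center_J.
  - by split; apply: e3_4; rewrite !inE eqxx ?orbT.
have : ip (J d) (J d) = 0.
  by rewrite {1}Jd ipNl ipZl vJd mulr0 oppr0.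
by rewrite ipJ d1 => /eqP; rewrite oner_eq0.
Qed.

End AdaptedPair.

(** The frame is e1, J e1, e2, J e2: invariance under J gives the relations with
mixed indices and the trace condition gives the first one. *)
Lemma exists_quat_frame : exists A B C : g, has_quat_frame A B C.
Proof.
have [e1 [e2 ad]] := exists_adapted_pair.
have [_ _ e2_lie] := ad.
exists (- [< e1, J e1 >]), (- [< e1, e2 >]), (- [< e1, J e2 >]).
exists e1, (J e1), e2, (J e2); split.
- rewrite -(adapted_span ad) !addvA !span_cons span_nil addv0 !addvA.
  exact: subvv.
- split; rewrite rpredN.
  + exact: lie_adapted_central ad.
  + by rewrite lieC rpredN.
  + by rewrite lie_Jr rpredN lieC rpredN.
- by rewrite opprK (adapted_trace ad).
- by rewrite opprK abJ.
- by rewrite opprK lie_Jr opprK.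
Qed.

End Construction.

Theorem proposition4p9 (R : realType) (g : lieAlgType R)
    (J : 'End(g)) (ip : {dot g for idfun}) :
  \dim {:g} = 8%N -> nilpotent g -> \dim (center g) = 4%N ->
  abelian_balanced J ip ->
  [\/ [/\ lie_isomorphic g (g1 R), ~ lie_isomorphic g (g2 R)
        & ~ lie_isomorphic g (g3 R)],
      [/\ ~ lie_isomorphic g (g1 R), lie_isomorphic g (g2 R)
        & ~ lie_isomorphic g (g3 R)]
    | [/\ ~ lie_isomorphic g (g1 R), ~ lie_isomorphic g (g2 R)
        & lie_isomorphic g (g3 R)]].
Proof.
move=> dim8 nil_g dimZ [[[JJ _] ipJ] [_ abJ] bal].
have [A [B [C qf]]] := exists_quat_frame dim8 dimZ nil_g JJ ipJ abJ bal.
have not_iso (h : lieAlgType R) : \dim (derived g) != \dim (derived h) ->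
    ~ lie_isomorphic g h.
  by move=> neq /dim_derived_iso eq; rewrite eq eqxx in neq.
have [] := lie_isomorphic_model dim8 dimZ qf => -[iso der].
- apply: Or31; split=> //; apply: not_iso.
    by rewrite der dim_derived_g2.
  by rewrite der dim_derived_g3.
- apply: Or32; split=> //; apply: not_iso.
    by rewrite der dim_derived_g1.
  by rewrite der dim_derived_g3.
- apply: Or33; split=> //; apply: not_iso.
    by rewrite der dim_derived_g1.
  by rewrite der dim_derived_g2.
Qed.
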